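(* Let $n\ge1$, let $\mathcal{L}$ be a lattice in $\mathbb{R}^{n+1}$, let $y_0>0$, and let $p\in\mathbb{R}^n\setminus\{0\}$. Then $\mathcal{P}(\mathcal{L}\cap\mathbf{B}_{y_0})$ has period $p$ if and only if one of the following holds: (i) $(p,0)\in\mathcal{L}$; or (ii) there are $b>0$ with $(0,b)\in\mathcal{L}$ and an element $(a,\beta)\in\mathcal{L}$ with $ma=p$ for some $m\in\mathbb{Z}$, and, for adapted generators $\{(0,b_0),(a_i,b_i),\ i=1,\ldots,n\}$ of $\mathcal{L}$ (with $m_*a_1=p$, $m_*\in\mathbb{Z}$), the following diophantine condition holds: for any $m_1,\ldots,m_n\in\mathbb{Z}$, $$\sum_{i=1}^n m_ib_i\in[0,y_0]\pmod{b_0}\quad\Longrightarrow\quad m_*b_1+\sum_{i=1}^n m_ib_i\in[0,y_0]\pmod{b_0}.$$ Here in (ii) the condition is required for any choice of adapted generators.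
   Context: Points of $\mathbb{R}^{n+1}$ are written $(x,y)$ with $x\in\mathbb{R}^n$, $y\in\mathbb{R}$. A lattice in $\mathbb{R}^{m}$ is the set of all integer combinations of $m$ linearly independent vectors (its generators). $\mathcal{P}:\mathbb{R}^{n+1}\to\mathbb{R}^n$ is $\mathcal{P}(x,y)=x$ and $\mathbf{B}_{y_0}=\{(x,y)\in\mathbb{R}^{n+1}:0\le y\le y_0\}$. The set $\mathcal{P}(\mathcal{L}\cap\mathbf{B}_{y_0})$ has period $p$ if $x+p\in\mathcal{P}(\mathcal{L}\cap\mathbf{B}_{y_0})$ for all $x\in\mathcal{P}(\mathcal{L}\cap\mathbf{B}_{y_0})$. Adapted generators (for $p$): when $\mathcal{L}$ contains some $(0,b)$ with $b>0$ and some $(p,q)$, these are generators of $\mathcal{L}$ over $\mathbb{Z}$ of the form $\{(0,b_0),(a_i,b_i),\ i=1,\ldots,n\}$, where $b_0>0$ and $(0,b_0)$ is the smallest nonzero element of $\mathcal{L}$ in the direction of $(0,1)$, $a_1,\ldots,a_n$ are linearly independent in $\mathbb{R}^n$, $0\le b_i<b_0$ for all $i$, and $m_*a_1=p$ for some $m_*\in\mathbb{Z}$. Such generators always exist in this situation. For $t\in\mathbb{R}$, ''$t\in[0,y_0]\pmod{b_0}$'' means that there is $s\in\mathbb{Z}$ with $t+sb_0\in[0,y_0]$. *)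

(* Defs.v *)
From mathcomp Require Import all_boot all_order all_algebra.
From mathcomp Require Import classical_sets reals.

Set Implicit Arguments.
Unset Strict Implicit.
Unset Printing Implicit Defensive.

Import Order.TTheory GRing.Theory Num.Theory.
Local Open Scope classical_set_scope.
Local Open Scope ring_scope.

(* The rows of G are linearly independent and L is the set of their integer
   combinations. *)
Definition generates_lattice (R : realType) (k m : nat) (G : 'M[R]_(k, m))
    (L : set 'rV[R]_m) : Prop :=
  row_free G /\
  L = [set v | exists c : 'I_k -> int, v = \sum_(i < k) row i G *~ c i].

Definition is_lattice (R : realType) (m : nat) (L : set 'rV[R]_m) : Prop :=
  exists G : 'M[R]_m, generates_lattice G L.

(* The point (x, y) of R^(n+1). *)
Definition pt (R : realType) (n : nat) (x : 'rV[R]_n) (y : R) : 'rV[R]_(n + 1) :=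
  row_mx x y%:M.

Definition proj (R : realType) (n : nat) (v : 'rV[R]_(n + 1)) : 'rV[R]_n :=
  lsubmx v.

Definition height (R : realType) (n : nat) (v : 'rV[R]_(n + 1)) : R :=
  rsubmx v 0 0.

Definition slab (R : realType) (n : nat) (y0 : R) : set 'rV[R]_(n + 1) :=
  [set v | 0 <= height v <= y0].
Arguments slab {R} n y0.

Definition has_period (R : realType) (n : nat) (S : set 'rV[R]_n)
    (p : 'rV[R]_n) : Prop :=
  forall x, S x -> S (x + p).

(* t \in [0, y0] (mod b0) *)
Definition in_seg_mod (R : realType) (y0 b0 t : R) : Prop :=
  exists s : int, 0 <= t + s%:~R * b0 <= y0.

(* (0, b0), (a i, b i) are adapted generators of L for p, and ms is the
   multiplier m_* with m_* a_1 = p. Indices start at 0, so that a_1 is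
   a (Ordinal hn), where hn is the proof that n is positive. *)
Definition adapted_generators (R : realType) (n : nat) (hn : (0 < n)%N)
    (L : set 'rV[R]_(n + 1)) (p : 'rV[R]_n)
    (b0 : R) (a : 'I_n -> 'rV[R]_n) (b : 'I_n -> R) (ms : int) : Prop :=
  [/\ generates_lattice
        (col_mx (pt 0 b0) (\matrix_(i < n) pt (a i) (b i))) L,
      [/\ 0 < b0, L (pt 0 b0) & forall t, 0 < t -> L (pt 0 t) -> b0 <= t],
      row_free (\matrix_(i < n) a i),
      forall i, 0 <= b i < b0
    & a (Ordinal hn) *~ ms = p].

Definition diophantine_condition (R : realType) (n : nat) (hn : (0 < n)%N)
    (y0 b0 : R) (b : 'I_n -> R) (ms : int) : Prop :=
  forall m : 'I_n -> int,
    in_seg_mod y0 b0 (\sum_(i < n) (m i)%:~R * b i) ->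
    in_seg_mod y0 b0
      (ms%:~R * b (Ordinal hn) + \sum_(i < n) (m i)%:~R * b i).

(* Main.v *)
Require Import Defs.
From mathcomp Require Import all_boot all_order all_algebra.
From mathcomp Require Import boolp classical_sets reals.

Set Implicit Arguments.
Unset Strict Implicit.
Unset Printing Implicit Defensive.

Import Order.TTheory GRing.Theory Num.Theory.
Local Open Scope classical_set_scope.
Local Open Scope ring_scope.

(** If (p, 0) is in L, translation by it preserves L and heights, so p is a
    period.  The remaining implications depend on whether the projection of L
    to R^n is injective, that is, on whether L has no vertical vector (0, b)
    with b > 0.

    Without a vertical vector, every point of P(L) has a well-defined height,
    and this height is additive.  Since 0 is in the projected set, so are all
    the multiples k p with k >= 0; if y is the height of p, then k y stays in
    [0, y0] for all k, whence y = 0 and (p, 0) is in L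
    ([no_vertical_period]).

    With a vertical vector, adapted generators turn the period into a
    statement about coefficients.  Every point over \sum m_i a_i has height
    \sum m_i b_i modulo b0, and the a_i being independent the m_i are
    determined by the projection; so \sum m_i a_i is in the projected set iff
    \sum m_i b_i is in [0, y0] modulo b0, and translating by p = m_* a_1
    replaces m_1 by m_1 + m_*.  Hence, for each choice of adapted generators,
    p is a period iff the diophantine condition holds for that choice
    ([has_period_diophantine]).

    Condition (ii) quantifies over all adapted generators, so its sufficiency
    requires that there be some ([adapted_generators_exist]).  They come from
    the fact that a row of integers is a multiple of a row of a unimodular
    matrix ([int_row_primitive], an instance of the Smith normal form), used
    twice: first to make the vertical direction contain a basis vector, then,
    in the projection, to do the same with the direction of p. *)

(** * Lattice bases as integer row vectors times a matrix *)

Local Notation intmx := (map_mx intr).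

Section Lattices.
Variable R : realType.

(** Writing integer combinations of the rows of G as products c *m G makes
    a change of generators a matrix product. *)
Lemma generates_latticeP (k m : nat) (G : 'M[R]_(k, m)) (L : set 'rV[R]_m) :
  generates_lattice G L <->
  row_free G /\ forall v, L v <-> exists c : 'rV[int]_k, v = intmx c *m G.
Proof.
have combE (c : 'I_k -> int) :
    \sum_(i < k) row i G *~ c i = intmx (\row_i c i) *m G.
  by rewrite mulmx_sum_row; apply: eq_bigr => i _; rewrite !mxE scaler_int.
split=> [[freeG ->]|[freeG LP]]; split=> //.
  move=> v; split=> [[c ->]|[c ->]]; first by exists (\row_i c i).
  exists (c 0); rewrite combE; congr (intmx _ *m _).
  by apply/rowP=> i; rewrite mxE.
apply/seteqP; split=> v /=.
  move=> /LP[c ->]; exists (c 0); rewrite combE; congr (intmx _ *m _).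
  by apply/rowP=> i; rewrite mxE.
by move=> [c ->]; apply/LP; exists (\row_i c i).
Qed.

Lemma generates_lattice_unimodular (k m : nat) (U : 'M[int]_k)
    (G : 'M[R]_(k, m)) (L : set 'rV[R]_m) :
  U \in unitmx -> generates_lattice G L -> generates_lattice (intmx U *m G) L.
Proof.
move=> unitU /generates_latticeP[freeG LP].
have VK : intmx (invmx U) *m intmx U = 1%:M :> 'M[R]_k.
  by rewrite -map_mxM mulVmx // map_mx1.
apply/generates_latticeP; split.
  rewrite /row_free mxrankMfree // -/(row_free _) row_free_unit.
  by case: (mulmx1_unit VK).
move=> v; split=> [/LP[c ->]|[c ->]].
  by exists (c *m invmx U); rewrite map_mxM mulmxA -(mulmxA (intmx c)) VK mulmx1.
by apply/LP; exists (c *m U); rewrite map_mxM mulmxA.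
Qed.

(** The Smith normal form of a one-row matrix has a single nonzero column, so
    only one row of its right unimodular factor survives in the product. *)
Lemma int_row_primitive (n : nat) (hn : (0 < n)%N) (e : 'rV[int]_n) :
  exists (g : int) (U : 'M[int]_n),
    U \in unitmx /\ e = g *: row (Ordinal hn) U.
Proof.
have [P _ [U unitU [d _ eE]]] := int_Smith_normal_form e.
exists (P 0 0 * d`_0), U; split=> //; rewrite {1}eE; apply/rowP=> j.
rewrite !mxE (bigD1 (Ordinal hn)) //= big1 ?addr0 => [|i i_neq0].
  by rewrite !mxE big_ord1 !mxE eqxx mulr1n.
rewrite !mxE big_ord1 !mxE /=.
have /negPf-> : 0%N != i :> nat by rewrite eq_sym.
by rewrite mulr0n mulr0 mul0r.
Qed.

(** * Elementary facts on lattices and slabs *)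

Lemma lattice_sub (m : nat) (L : set 'rV[R]_m) u v :
  is_lattice L -> L u -> L v -> L (u - v).
Proof.
move=> [G /generates_latticeP[_ LP]] /LP[c ->] /LP[d ->].
by apply/LP; exists (c - d); rewrite map_mxB mulmxBl.
Qed.

(** The blocks of a basis are taken in 1 + n rows, whereas the ambient space
    has dimension n + 1. *)
Lemma lattice_basis_cast (m k : nat) (L : set 'rV[R]_m) :
  is_lattice L -> m = k -> exists G : 'M[R]_(k, m), generates_lattice G L.
Proof. by move=> [G genG] e; case: k / e; exists G. Qed.

Lemma ptK (n : nat) (v : 'rV[R]_(n + 1)) : v = pt (proj v) (height v).
Proof. by rewrite /pt /height -mx11_scalar hsubmxK. Qed.

Lemma pt_proj (n : nat) (x : 'rV[R]_n) (y : R) : proj (pt x y) = x.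
Proof. exact: row_mxKl. Qed.

Lemma pt_height (n : nat) (x : 'rV[R]_n) (y : R) : height (pt x y) = y.
Proof. by rewrite /height /pt row_mxKr mxE eqxx mulr1n. Qed.

Lemma pt_sub (n : nat) (x x' : 'rV[R]_n) (y y' : R) :
  pt x y - pt x' y' = pt (x - x') (y - y').
Proof. by rewrite /pt opp_row_mx add_row_mx raddfB. Qed.

Lemma slab_projP (n : nat) (L : set 'rV[R]_(n + 1)) (y0 : R) x :
  (@proj R n @` (L `&` slab n y0)) x <-> exists y, L (pt x y) /\ 0 <= y <= y0.
Proof.
split=> [[v [Lv hv] <-]|[y [Lxy hy]]]; first by exists (height v); rewrite -ptK.
by exists (pt x y); rewrite ?pt_proj //; split=> //; rewrite /slab /= pt_height.
Qed.

Lemma matrix_pt (n : nat) (a : 'I_n -> 'rV[R]_n) (b : 'I_n -> R) :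
  \matrix_(i < n) pt (a i) (b i) =
  row_mx (\matrix_(i < n) a i) (\col_(i < n) b i).
Proof.
apply/row_matrixP=> i; rewrite rowK row_row_mx rowK; congr row_mx.
by apply/rowP=> j; rewrite !ord1 !mxE eqxx mulr1n.
Qed.

(** * Bases with a vertical vector *)

Section Coordinates.
Variables (n : nat) (b0 : R) (A : 'M[R]_n) (B : 'cV[R]_n).

Let H : 'M[R]_(1 + n, n + 1) := col_mx (pt 0 b0) (row_mx A B).

(** A relation u *m A = 0 makes u *m (row_mx A B) vertical, hence a multiple of
    (0, b0), which is a relation between the rows of H. *)
Lemma vertical_basis_row_free : b0 != 0 -> row_free H -> row_free A.
Proof.
move=> b0_neq0 freeH; apply/row_freeP.
suff: row_free A by move/row_freeP.
rewrite -kermx_eq0; apply/rowV0P=> u /sub_kermxP uA.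
have: row_mx (- (b0^-1 *: (u *m B))) u *m H = 0 *m H.
  rewrite mul0mx mul_row_col /pt !mul_mx_row mulmx0 uA add_row_mx addr0.
  rewrite mul_mx_scalar scalerN scalerA mulfV // scale1r addNr.
  by rewrite row_mx0.
move/(row_free_inj freeH); rewrite -row_mx0.
by case/eq_row_mx.
Qed.

Lemma vertical_basis_coordinates (L : set 'rV[R]_(n + 1)) :
  generates_lattice H L -> forall x y, L (pt x y) <->
  exists (s : int) (c : 'rV[int]_n),
    x = intmx c *m A /\ y = s%:~R * b0 + (intmx c *m B) 0 0.
Proof.
move=> /generates_latticeP[_ LP] x y.
have combE (s : 'M[int]_1) (c : 'rV[int]_n) : intmx (row_mx s c) *m H =
    pt (intmx c *m A) ((s 0 0)%:~R * b0 + (intmx c *m B) 0 0).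
  rewrite map_row_mx mul_row_col /pt !mul_mx_row mulmx0 add_row_mx add0r.
  congr row_mx; apply/matrixP=> i j; rewrite !ord1 mul_mx_scalar !mxE eqxx mulr1n.
  by rewrite mulrC.
split=> [/LP[c]|[s [c [-> ->]]]].
  rewrite -[c]hsubmxK combE => /eq_row_mx[-> /matrixP/(_ 0 0)].
  rewrite !mxE eqxx !mulr1n => ->; exists (lsubmx c 0 0), (rsubmx c); split=> //.
  by rewrite !mxE.
by apply/LP; exists (row_mx s%:M c); rewrite combE !mxE eqxx mulr1n.
Qed.

End Coordinates.

(** If (0, b) = e *m G with e = g *: (row 0 of U), then row 0 of the basis
    U *m G is (0, b) divided by g, hence vertical. *)
Lemma vertical_basis_exists (n : nat) (L : set 'rV[R]_(n + 1)) (b : R) :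
  is_lattice L -> b != 0 -> L (pt 0 b) ->
  exists (t : R) (A : 'M[R]_n) (B : 'cV[R]_n),
    t != 0 /\ generates_lattice (col_mx (pt 0 t) (row_mx A B)) L.
Proof.
move=> latL b_neq0 Lb.
have [G genG] := lattice_basis_cast latL (addnC n 1).
have /generates_latticeP[_ LP] := genG.
have {LP}[e eE] := (LP _).1 Lb.
have [g [U [unitU]]] := @int_row_primitive (1 + n) isT e.
set G1 := intmx U *m G => egU.
have {eE egU}: pt 0 b = g%:~R *: row (lshift n ord0) G1.
  rewrite eE egU map_mxZ -scalemxAl map_row -row_mul.
  by congr (_ *: row _ _); apply: val_inj.
have {genG unitU}: generates_lattice G1 L by exact: generates_lattice_unimodular.
move: G1 => G1.
rewrite -[G1]vsubmxK -[dsubmx G1]hsubmxK.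
move: (lsubmx (dsubmx G1)) (rsubmx (dsubmx G1)) (usubmx G1) => A B r {G1 G U}.
rewrite rowKu row_id.
rewrite [r]ptK; set t := height r => genG1 btE.
have [rx0 btE']: g%:~R *: proj r = 0 /\ b = g%:~R * t.
  move: btE; rewrite /pt scale_row_mx => /eq_row_mx[<- /matrixP/(_ 0 0)].
  by rewrite !mxE eqxx !mulr1n.
have t_neq0 : t != 0 by apply: contraNneq b_neq0 => t0; rewrite btE' t0 mulr0.
have g_neq0 : g%:~R != 0 :> R.
  by apply: contraNneq b_neq0 => g0; rewrite btE' g0 mul0r.
move/eqP: rx0; rewrite scaler_eq0 (negPf g_neq0) /= => /eqP rx0.
rewrite {}rx0 in genG1.
by exists t, A, B.
Qed.

(** * Adapted generators *)

Section AdaptedGenerators.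
Variables (n : nat) (hn : (0 < n)%N) (L : set 'rV[R]_(n + 1)) (p : 'rV[R]_n).

Let i0 := Ordinal hn.

(** Starting from a basis with rows (0, t) and (A, B), where the projection of
    (a, beta) has integer coordinates f = k *: (first row of V) on A, the rows of A
    are changed by V, which makes a, and so p, a multiple of the first of them;
    then multiples of (0, t) are subtracted to bring the heights to [0, |t|[.
    The result has (0, |t|) as shortest vertical vector because the
    projections of the other generators are independent. *)
Lemma adapted_generators_exist (b : R) (a : 'rV[R]_n) (beta : R) (m : int) :
  is_lattice L -> 0 < b -> L (pt 0 b) -> L (pt a beta) ->
  a *~ m = p ->
  exists b0 a' b' ms, adapted_generators hn L p b0 a' b' ms.
Proof.
move=> latL b_gt0 Lb La am.
have [t [A [B [t_neq0 genG1]]]] :=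
  vertical_basis_exists latL (lt0r_neq0 b_gt0) Lb.
have [_ [f [aE _]]] := (vertical_basis_coordinates genG1 a beta).1 La.
have [k [V [unitV fE]]] := int_row_primitive hn f.
(* W performs all three changes at once: the sign of t, the passage from A to
   V *m A, and the subtraction of F i times b0 from the height of row i; as
   the latter is done with (0, t), F is multiplied by the sign of t. *)
pose b0 := `|t|.
have b0_gt0 : 0 < b0 by rewrite normr_gt0.
pose F : 'cV[int]_n := \col_i Num.floor ((intmx V *m B) i 0 / b0).
pose W := block_mx (sgz t)%:M 0 (- sgz t *: F) V : 'M[int]_(1 + n).
pose A' := intmx V *m A.
pose B' := intmx V *m B - b0 *: intmx F.
have unitW : W \in unitmx.
  rewrite unitmxE det_lblock unitrM -unitmxE -[\det V \is a _]unitmxE unitV andbT.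
  rewrite unitmxE det_scalar1.
  by rewrite /sgz (negPf t_neq0); case: (t < 0).
have sgt : (sgz t)%:~R * t = b0 by rewrite -[RHS]/`|t| normrEsg sgrEz.
have WE : intmx W *m col_mx (pt 0 t) (row_mx A B) =
    col_mx (pt 0 b0) (row_mx A' B').
  rewrite map_block_mx mul_block_col map_scalar_mx /= map_mx0 mul0mx addr0.
  rewrite mul_scalar_mx /pt scale_row_mx scaler0 scale_scalar_mx sgt.
  congr col_mx; rewrite !mul_mx_row mulmx0 add_row_mx add0r.
  congr row_mx; rewrite addrC; congr (_ + _).
  rewrite mul_mx_scalar map_mxZ scalerA rmorphN mulrN mulrC sgt.
  by rewrite scaleNr.
have genH := generates_lattice_unimodular unitW genG1.
rewrite {}WE in genH.
have freeA' : row_free A'.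
  by have [freeH _] := genH; apply: vertical_basis_row_free freeH; rewrite gt_eqF.
have rowsA' : \matrix_(i < n) row i A' = A' by apply/row_matrixP=> i; rewrite rowK.
exists b0, (fun i => row i A'), (fun i => B' i 0), (k * m); split.
- have -> : \matrix_(i < n) pt (row i A') (B' i 0) = row_mx A' B'.
    by rewrite matrix_pt rowsA'; congr row_mx; apply/colP=> i; rewrite mxE.
  exact: genH.
- split=> // [|s s_gt0].
    apply/(vertical_basis_coordinates genH); exists 1, 0.
    by rewrite map_mx0 !mul0mx mul1r mxE addr0.
  move/(vertical_basis_coordinates genH)=> [z [c [c0 sE]]].
  have {}c0 : intmx c = 0 :> 'rV[R]_n by apply: (row_free_inj freeA'); rewrite mul0mx -c0.
  move: s_gt0; rewrite sE c0 mul0mx mxE addr0 pmulr_lgt0 // ltr0z => z_gt0.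
  by rewrite ler_peMl ?(ltW b0_gt0) // ler1z -gtz0_ge1.
- by rewrite rowsA'.
- move=> i.
  have -> : B' i 0 = (intmx V *m B) i 0 -
      b0 * (Num.floor ((intmx V *m B) i 0 / b0))%:~R by rewrite !mxE.
  move: ((intmx V *m B) i 0) => q.
  have -> : q - b0 * (Num.floor (q / b0))%:~R =
      (q / b0 - (Num.floor (q / b0))%:~R) * b0.
    by rewrite mulrBl divfK ?gt_eqF // [b0 * _]mulrC.
  rewrite pmulr_lge0 // gtr_pMl // subr_ge0 ge_floor /=.
  by rewrite ltrBlDl -[1]/(1%:~R) -intrD floorD1_gt.
rewrite -am aE fE map_mxZ -scalemxAl map_row -row_mul.
by rewrite mulrzA scaler_int.
Qed.

Variables (b0 : R) (a : 'I_n -> 'rV[R]_n) (b : 'I_n -> R) (ms : int).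
Hypothesis adapted : adapted_generators hn L p b0 a b ms.

Lemma adapted_coordinates x y : L (pt x y) <->
  exists (s : int) (m : 'I_n -> int),
    x = \sum_(i < n) a i *~ m i /\
    y = \sum_(i < n) (m i)%:~R * b i + s%:~R * b0.
Proof.
have [genL _ _ _ _] := adapted; rewrite matrix_pt in genL.
have xE (c : 'rV[int]_n) :
    intmx c *m (\matrix_(i < n) a i) = \sum_(i < n) a i *~ c 0 i.
  by rewrite mulmx_sum_row; apply: eq_bigr => i _; rewrite mxE rowK scaler_int.
have yE (c : 'rV[int]_n) :
    (intmx c *m (\col_(i < n) b i)) 0 0 = \sum_(i < n) (c 0 i)%:~R * b i.
  by rewrite mxE; apply: eq_bigr => i _; rewrite !mxE.
split=> [/(vertical_basis_coordinates genL)[s [c [-> ->]]]|[s [m [-> ->]]]].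
  by exists s, (c 0); rewrite xE yE addrC.
apply/(vertical_basis_coordinates genL); exists s, (\row_i m i).
rewrite xE yE addrC; split; last congr (_ + _).
all: by apply: eq_bigr => i _; rewrite mxE.
Qed.

Lemma adapted_coordinates_uniq (m m' : 'I_n -> int) :
  \sum_(i < n) a i *~ m i = \sum_(i < n) a i *~ m' i -> m =1 m'.
Proof.
have [_ _ freeA _ _] := adapted => mE i.
have xE (c : 'I_n -> int) :
    \sum_(i < n) a i *~ c i = intmx (\row_i c i) *m (\matrix_(i < n) a i).
  by rewrite mulmx_sum_row; apply: eq_bigr => j _; rewrite !mxE rowK scaler_int.
move: mE; rewrite !xE => /(row_free_inj freeA)/rowP/(_ i).
by rewrite !mxE => /intr_inj.
Qed.

(* The coefficients of x + p when m are those of x; the diophantine condition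
   compares their heights. *)
Let shift (m : 'I_n -> int) i := m i + ms *+ (i == i0).

Let shift_sum (V : zmodType) (f : 'I_n -> V) (m : 'I_n -> int) :
  \sum_(i < n) f i *~ shift m i = f i0 *~ ms + \sum_(i < n) f i *~ m i.
Proof.
rewrite (bigD1 i0) //= [in RHS](bigD1 i0) //= addrA /shift eqxx mulr1n.
rewrite mulrzDr [f i0 *~ ms + _]addrC; congr (_ + _); apply: eq_bigr => i /negPf->.
by rewrite mulr0n addr0.
Qed.

Let shift_height (m : 'I_n -> int) :
  \sum_(i < n) (shift m i)%:~R * b i =
  ms%:~R * b i0 + \sum_(i < n) (m i)%:~R * b i.
Proof.
rewrite mulrzl (eq_bigr _ (fun i _ => mulrzl (b i) (shift m i))) shift_sum.
by congr (_ + _); apply: eq_bigr => i _; rewrite mulrzl.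
Qed.

Let shift_proj (m : 'I_n -> int) :
  \sum_(i < n) a i *~ shift m i = \sum_(i < n) a i *~ m i + p.
Proof. by rewrite shift_sum addrC; have [_ _ _ _ ->] := adapted. Qed.

(** The coefficients m_i of a lattice point are determined by its projection
    (this is where the independence of the a_i is used), while the multiple of
    (0, b0) is free: membership in the projected set is membership of the
    height in [0, y0] modulo b0. *)
Lemma has_period_diophantine (y0 : R) :
  has_period (@proj R n @` (L `&` slab n y0)) p <->
  diophantine_condition hn y0 b0 b ms.
Proof.
split=> [per m [s hs]|dio x /slab_projP[y [Lxy hy]]].
  have /per/slab_projP[y [Lxy hy]] :
      (@proj R n @` (L `&` slab n y0)) (\sum_(i < n) a i *~ m i).
    apply/slab_projP; exists (\sum_(i < n) (m i)%:~R * b i + s%:~R * b0).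
    by split=> //; apply/adapted_coordinates; exists s, m.
  have [s' [m' [xE yE]]] := (adapted_coordinates _ _).1 Lxy.
  rewrite -shift_proj in xE.
  exists s'; rewrite -shift_height.
  by under eq_bigr do rewrite (adapted_coordinates_uniq xE); rewrite -yE.
have [s [m [xE yE]]] := (adapted_coordinates _ _).1 Lxy.
have [|s' hs'] := dio m; first by exists s; rewrite -yE.
apply/slab_projP; eexists; split; last exact: hs'.
apply/adapted_coordinates; exists s', (shift m).
by rewrite shift_proj xE shift_height.
Qed.

End AdaptedGenerators.

(** * Lattices that project injectively *)

(** The projection is injective on L, so the lattice point over p *+ k must be
    the k-th multiple of the one over p; its height is bounded by y0 for all
    k, which forces the latter to have height 0. *)
Lemma no_vertical_period (n : nat) (L : set 'rV[R]_(n + 1)) (y0 : R) p :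
  is_lattice L -> 0 <= y0 -> ~ (exists b : R, 0 < b /\ L (pt 0 b)) ->
  has_period (@proj R n @` (L `&` slab n y0)) p -> L (pt p 0).
Proof.
move=> latL y0_ge0 novert per.
have Linj x y y' : L (pt x y) -> L (pt x y') -> y = y'.
  wlog lt_yy' : y y' / y < y' => [wl|] Ly Ly'.
    by have [/wl->|/wl->|] := ltgtP y y'.
  case: novert; exists (y' - y); rewrite subr_gt0; split=> //.
  by rewrite -(subrr x) -pt_sub; apply: lattice_sub.
have L0 : L (pt 0 0).
  have [G /generates_latticeP[_ LP]] := latL; apply/LP; exists 0.
  by rewrite map_mx0 mul0mx /pt raddf0 row_mx0.
have Ladd x y x' y' : L (pt x y) -> L (pt x' y') -> L (pt (x + x') (y + y')).
  move=> Lx Lx'; rewrite -[x']opprK -[y']opprK -pt_sub; apply: lattice_sub => //.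
  by rewrite -[- x']sub0r -[- y']sub0r -pt_sub; apply: lattice_sub.
have S0 : (@proj R n @` (L `&` slab n y0)) 0.
  by apply/slab_projP; exists 0; rewrite lexx.
have /slab_projP[y [Lpy /andP[y_ge0 _]]] := per _ S0; rewrite add0r in Lpy.
have Sk k : (@proj R n @` (L `&` slab n y0)) (p *+ k).
  by elim: k => [|k IH]; rewrite ?mulr0n // mulrSr; apply: per.
have Lk k : L (pt (p *+ k) (y *+ k)).
  by elim: k => [|k IH]; rewrite ?mulr0n // !mulrSr; apply: Ladd.
have yk k : y *+ k <= y0.
  have /slab_projP[z [Lz /andP[_]]] := Sk k.
  by rewrite (Linj _ _ _ (Lk k) Lz).
have [y0E|y_neq0] := eqVneq y 0; first by rewrite -y0E.
have y_gt0 : 0 < y by rewrite lt_def y_neq0.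
have := archi_boundP (divr_ge0 y0_ge0 y_ge0).
by rewrite ltr_pdivrMr // mulr_natl ltNge yk.
Qed.

End Lattices.

(** * The characterisation of periods *)

Theorem theorem3p1 (R : realType) (n : nat) (hn : (0 < n)%N)
    (L : set 'rV[R]_(n + 1)) (hL : is_lattice L)
    (y0 : R) (hy0 : 0 < y0) (p : 'rV[R]_n) (hp : p != 0) :
  has_period (@proj R n @` (L `&` slab n y0)) p <->
  (L (pt p 0) \/
   [/\ exists b : R, 0 < b /\ L (pt 0 b),
       exists (a : 'rV[R]_n) (beta : R) (m : int),
         L (pt a beta) /\ a *~ m = p
     & forall (b0 : R) (a : 'I_n -> 'rV[R]_n) (b : 'I_n -> R) (ms : int),
         adapted_generators hn L p b0 a b ms ->
         diophantine_condition hn y0 b0 b ms]).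
Proof.
split=> [per|[Lp0|[[b [b_gt0 Lb]] [a [beta [m [La am]]]] dio]]].
- have [vert|novert] := pselect (exists b : R, 0 < b /\ L (pt 0 b)); last first.
    by left; apply: no_vertical_period novert per => //; apply: ltW.
  right; split=> // [|b0 a b ms adapted].
    have /per/slab_projP[q [Lq _]] : (@proj R n @` (L `&` slab n y0)) 0.
      have [b [_ Lb]] := vert.
      apply/slab_projP; exists 0; split; last by rewrite lexx ltW.
      by have := lattice_sub hL Lb Lb; rewrite pt_sub !subrr.
    by rewrite add0r in Lq; exists p, q, 1; rewrite mulr1z.
  exact: (has_period_diophantine adapted y0).1.
- move=> x /slab_projP[y [Lxy hy]]; apply/slab_projP; exists y; split=> //.
  have L0 : L (pt 0 0) by have := lattice_sub hL Lp0 Lp0; rewrite pt_sub !subrr.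
  have := lattice_sub hL Lxy (lattice_sub hL L0 Lp0).
  by rewrite !pt_sub !sub0r opprK oppr0 subr0.
have [b0 [a' [b' [ms adapted]]]] :=
  adapted_generators_exist hn hL b_gt0 Lb La am.
by apply/(has_period_diophantine adapted y0)/dio/adapted.
Qed.
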